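(* Let $T$ be a tree with at least $3$ vertices, and fix integers $d\ge 2$ and $\ell\ge 0$. Then $\mathbf{G}_T$ determines $L_{d,\ell}(T)$: if $T'$ is another tree with at least $3$ vertices and $\mathbf{G}_T=\mathbf{G}_{T'}$, then $L_{d,\ell}(T)=L_{d,\ell}(T')$.
   Context: All graphs are finite and simple. For a tree $T$ and $A\subseteq V(T)$, $e(A)$ is the number of edges of $T$ with both endpoints in $A$ and $d(A)$ the number with exactly one endpoint in $A$; $\mathbf{G}_T(x,y,z)=\sum_{A\subseteq V(T)} x^{|A|}y^{d(A)}z^{e(A)}$. For $v\in V(T)$, $\ell(v)$ is the number of leaves of $T$ adjacent to $v$, and $L_{d,\ell}(T)$ is the number of vertices $v$ with $\deg(v)=d$ and $\ell(v)=\ell$. *)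

(* Defs.v *)
From HB Require Import structures.
From mathcomp Require Import all_boot all_order all_algebra.
From mathcomp Require Import mpoly.

Set Implicit Arguments.
Unset Strict Implicit.
Unset Printing Implicit Defensive.

Import GRing.Theory.
Local Open Scope ring_scope.

Record sgraph := SGraph {
  vertex :> finType;
  adj : rel vertex;
  adj_sym : ssrbool.symmetric adj;
  adj_irr : irreflexive adj
}.

Section SimpleGraph.
Variable G : sgraph.
Implicit Types (v : G) (A : {set G}).

Definition edges : {set {set G}} :=
  [set E : {set G} | [exists x : G, exists y : G, adj x y && (E == [set x; y])]].

Definition neighbours v : {set G} := [set u : G | adj v u].

Definition deg v : nat := #|neighbours v|.

Definition leaf v : bool := deg v == 1%N.

Definition connected_graph : Prop :=
  (0 < #|G|)%N /\ forall x y : G, connect (@adj G) x y.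

(* A cycle has at least three vertices: the closed walk [:: x; y] along a
   single edge satisfies ucycle but is not a cycle of a simple graph. *)
Definition acyclic : Prop :=
  forall c : seq G, (3 <= size c)%N -> ~ ucycle (@adj G) c.

Definition is_tree : Prop := connected_graph /\ acyclic.

Definition inner_edges A : nat := #|[set E in edges | E \subset A]|.

Definition boundary_edges A : nat := #|[set E in edges | #|E :&: A| == 1%N]|.

(* 'X_0, 'X_1 and 'X_2 are the variables x, y and z. *)
Definition gen_degree_poly : {mpoly int[3]} :=
  \sum_(A : {set G})
    'X_(inord 0) ^+ #|A| * 'X_(inord 1) ^+ boundary_edges A
      * 'X_(inord 2) ^+ inner_edges A.

Definition num_leaf_neighbours v : nat := #|[set u in neighbours v | leaf u]|.

Definition num_deg_leaf (d l : nat) : nat :=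
  #|[set v : G | (deg v == d) && (num_leaf_neighbours v == l)]|.

End SimpleGraph.

(* Main.v *)
Require Import Defs.
From HB Require Import structures.
From mathcomp Require Import all_boot all_order all_algebra.
From mathcomp Require Import mpoly.
From mathcomp Require Import ring zify.

(* Specialise G_T to F_T(X) = sum_A (X - 1)^|A| y^(sum_{v in A} (deg v - 1)) t^e(A)
   with t = 1 + (1 - w) X; the handshake identity d(A) + 2 e(A) = sum_{v in A} deg v
   makes this possible.  Since no two leaves are adjacent, the sum over the leaves in A
   factors over leaves: a leaf contributes X if its neighbour is outside A and
   X (w + (1 - w) X) if it is inside.  Hence F_T = X^L Q_T, with L the number of
   leaves, and Q_T(0) is a sum over sets B of non-leaves in which t = 1, so it is the
   product over non-leaves v of 1 - y^(deg v - 1) w^l(v).  It is nonzero, hence F_T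
   determines it; and a product of factors 1 - m, with m a nontrivial monomial,
   determines its factors, because the least m and its multiplicity can be read off
   the lowest nonconstant term. *)

Set Implicit Arguments.
Unset Strict Implicit.
Unset Printing Implicit Defensive.

Import Order.TTheory GRing.Theory Num.Theory.
Local Open Scope ring_scope.

Lemma seq_has_minimum (disp : Order.disp_t) (T : orderType disp) (s : seq T) :
  s != [::] -> exists2 m, m \in s & all (>= m)%O s.
Proof.
rewrite -size_eq0 -(size_sort <=%O); case sort_s: (sort <=%O s) => [|m r] // _.
exists m; first by rewrite -(mem_sort <=%O) sort_s mem_head.
rewrite -(all_sort _ <=%O) sort_s /= lexx.
by apply: order_path_min le_trans _; have := sort_le_sorted s; rewrite sort_s.
Qed.

Section MonomialCoefficients.
Variables (n : nat) (R : nzRingType).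
Implicit Types (m k : 'X_{1..n}) (s : seq 'X_{1..n}) (p : {mpoly R[n]}).

Lemma mcoeffXM m p k :
  ('X_[m] * p)@_k = if (m <= k)%MM then p@_(k - m) else 0.
Proof.
rewrite -commr_mpolyX; case: ifPn => [le_mk|not_le_mk].
  by rewrite -{1}(submK le_mk) addmC mcoeffMX.
apply: contraNeq not_le_mk; rewrite -mcoeff_msupp (perm_mem (msuppMX _ _)).
by case/mapP => m' _ ->; apply: lem_addr.
Qed.

Lemma mcoeff_prod_1sub_mpolyX m s k :
    m != 0%MM -> all (>= m)%O s -> (k <= m)%O ->
  (\prod_(e <- s) (1 - 'X_[R, e]))@_k =
    (k == 0%MM)%:R - (k == m)%:R *+ count_mem m s.
Proof.
move=> m_neq0; elim: s k => [|e s IHs] k /=.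
  by rewrite big_nil mcoeff1 mulr0n subr0.
case/andP=> le_me le_ms le_km; rewrite big_cons mulrBl mul1r mcoeffB mcoeffXM.
rewrite IHs // mulrnDr opprD addrCA [RHS]addrC; congr (_ - _).
case: ifPn => [le_ek|not_le_ek].
  have eq_ek : e = k.
    by apply: le_anti; rewrite lem_leo // (le_trans le_km).
  have eq_km : k = m by apply: le_anti; rewrite le_km -eq_ek.
  have -> : (k - e)%MM = 0%MM by apply/mnmP => i; rewrite mnmBE eq_ek subnn mnm0E.
  by rewrite IHs ?le0m // eq_ek eq_km !eqxx eq_sym (negPf m_neq0) mul0rn subr0.
case: (eqVneq e m) => [eq_em|]; last by rewrite mulr0n.
by case: eqP not_le_ek => // ->; rewrite eq_em lepm_refl.
Qed.

Lemma sub1_mpolyX_eq0 m : (1 - 'X_[R, m] == 0) = (m == 0%MM).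
Proof.
rewrite subr_eq0; apply/eqP/eqP => [eq_X|->]; last by rewrite mpolyX0.
have := congr1 (mcoeff m) eq_X; rewrite mcoeff1 mcoeffX eqxx.
by case: eqP => // _ /eqP; rewrite eq_sym oner_eq0.
Qed.

End MonomialCoefficients.

Section MonomialMultisets.
Variables (n : nat) (R : numDomainType).
Implicit Types (m : 'X_{1..n}) (s : seq 'X_{1..n}).

Lemma perm_eq_sum_mpolyX s1 s2 :
    \sum_(m <- s1) 'X_[m] = \sum_(m <- s2) 'X_[m] :> {mpoly R[n]} ->
  perm_eq s1 s2.
Proof.
have coefE s k : (\sum_(m <- s) 'X_[R, m])@_k = (count_mem k s)%:R.
  rewrite raddf_sum -sum1_count natr_sum [RHS]big_mkcond /=.
  by apply: eq_bigr => m _; rewrite mcoeffX; case: eqP.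
move=> eq_sum; apply/allP => k _ /=.
by rewrite -(@eqr_nat R) -!coefE eq_sum.
Qed.

Lemma eq_count_prod_1sub_mpolyX m s1 s2 :
    m != 0%MM -> all (>= m)%O s1 -> all (>= m)%O s2 ->
    \prod_(e <- s1) (1 - 'X_[e]) = \prod_(e <- s2) (1 - 'X_[e]) :> {mpoly R[n]} ->
  count_mem m s1 = count_mem m s2.
Proof.
move=> m_neq0 le_ms1 le_ms2 /(congr1 (mcoeff m)).
rewrite !(mcoeff_prod_1sub_mpolyX _ m_neq0) // eqxx.
by move=> /addrI/oppr_inj/eqP; rewrite eqr_nat => /eqP.
Qed.

Lemma prod_1sub_mpolyX_neq0 s :
  0%MM \notin s -> \prod_(m <- s) (1 - 'X_[R, m]) != 0.
Proof.
move=> s_0; rewrite prodf_seq_neq0; apply/allP => m m_s /=.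
by rewrite sub1_mpolyX_eq0; apply: contraNneq s_0 => <-.
Qed.

Lemma perm_eq_prod_1sub_mpolyX s1 s2 :
    0%MM \notin s1 -> 0%MM \notin s2 ->
    \prod_(m <- s1) (1 - 'X_[m]) = \prod_(m <- s2) (1 - 'X_[m]) :> {mpoly R[n]} ->
  perm_eq s1 s2.
Proof.
have [N] := ubnP (size s1).
elim: N s1 s2 => // N IHN s1 s2 lt_s1 s1_0 s2_0 eq_prod.
have [/eqP|/seq_has_minimum[m m_s]] := eqVneq (s1 ++ s2) [::].
  by rewrite -size_eq0 size_cat addn_eq0 !size_eq0 => /andP[/eqP-> /eqP->].
rewrite all_cat => /andP[m_min1 m_min2].
have m_neq0 : m != 0%MM.
  by apply: contraTneq m_s => ->; rewrite mem_cat negb_or s1_0.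
have eq_count := eq_count_prod_1sub_mpolyX m_neq0 m_min1 m_min2 eq_prod.
have [m_s1 m_s2] : m \in s1 /\ m \in s2.
  by move: m_s; rewrite mem_cat -!has_pred1 !has_count eq_count orbb.
rewrite (permPl (perm_to_rem m_s1)) perm_sym (permPl (perm_to_rem m_s2)) perm_cons.
rewrite perm_sym; apply: IHN.
- by rewrite size_rem // -ltnS prednK //; case: (s1) m_s1.
- by apply: contra s1_0 => /mem_rem.
- by apply: contra s2_0 => /mem_rem.
- move: eq_prod; rewrite (perm_big _ (perm_to_rem m_s1)).
  rewrite [RHS](perm_big _ (perm_to_rem m_s2)) !big_cons; apply: mulfI.
  by rewrite sub1_mpolyX_eq0.
Qed.

End MonomialMultisets.

Section EdgeCounts.
Variable G : sgraph.
Implicit Types (u v : G) (A B C E : {set G}).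

Lemma edge_through E u :
  E \in edges G -> u \in E -> exists2 v, adj u v & E = [set u; v].
Proof.
rewrite inE => /existsP[a /existsP[b /andP[ab /eqP->]]].
rewrite !inE => /orP[]/eqP->; first by exists b.
by exists a; [rewrite adj_sym | rewrite setUC].
Qed.

Lemma card_edge E : E \in edges G -> #|E| = 2.
Proof.
rewrite inE => /existsP[a /existsP[b /andP[ab /eqP->]]].
by rewrite cards2; case: eqP ab => // ->; rewrite adj_irr.
Qed.

Lemma set2_edges u v : ([set u; v] \in edges G) = adj u v.
Proof.
apply/idP/idP => [uvE|uv]; last first.
  by rewrite inE; apply/existsP; exists u; apply/existsP; exists v; rewrite uv eqxx.
have [w uw eq_uv] := edge_through uvE (set21 u v).
have : w \in [set u; v] by rewrite eq_uv set22.
by rewrite !inE => /orP[]/eqP eq_w; move: uw; rewrite eq_w ?adj_irr.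
Qed.

Lemma card_incident_edges v (P : pred {set G}) :
  #|[set E in edges G | (v \in E) && P E]| = #|[set u in neighbours v | P [set v; u]]|.
Proof.
have set2_inj : {in [set u in neighbours v | P [set v; u]] &,
                 injective (fun u => [set v; u])}.
  move=> u w; rewrite !inE => /andP[vu _] _ eq_set.
  have : u \in [set v; w] by rewrite -eq_set set22.
  by rewrite !inE => /orP[]/eqP // eq_uv; rewrite eq_uv adj_irr in vu.
rewrite -(card_in_imset set2_inj); apply: eq_card => E.
apply/idP/imsetP => [|[u]]; rewrite inE.
  case/and3P=> EG vE PE; have [u vu eqE] := edge_through EG vE.
  by exists u; rewrite // !inE vu -eqE PE.
by rewrite inE => /andP[]; rewrite inE => vu Pvu ->; rewrite set2_edges vu set21 Pvu.
Qed.

Lemma sum_card_neighbours_edges A (P : pred {set G}) :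
  (\sum_(v in A) #|[set u in neighbours v | P [set v; u]]| =
   \sum_(E in edges G | P E) #|E :&: A|)%N.
Proof.
under eq_bigr do rewrite -card_incident_edges -sum1_card.
rewrite (exchange_big_dep (fun E => (E \in edges G) && P E)) /=; last first.
  by move=> v E _; rewrite inE => /and3P[-> _ ->].
apply: eq_bigr => E /andP[EG PE]; rewrite -sum1_card; apply: eq_bigl => v.
by rewrite inE EG PE andbT inE andbC.
Qed.

Lemma edge_subsetE E A : E \in edges G -> (E \subset A) = (#|E :&: A| == 2).
Proof.
move=> EG; rewrite (sameP setIidPl eqP) eqEcard subsetIl (card_edge EG).
by rewrite eqn_leq -{2}(card_edge EG) subset_leq_card ?subsetIl.
Qed.

Lemma handshake A :
  (boundary_edges A + 2 * inner_edges A = \sum_(v in A) deg v)%N.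
Proof.
have degE v : deg v = #|[set u in neighbours v | predT [set v; u]]|.
  by apply: eq_card => u; rewrite [RHS]inE andbT.
under [RHS]eq_bigr do rewrite degE.
rewrite sum_card_neighbours_edges /boundary_edges /inner_edges -!sum1dep_card.
rewrite !big_mkcondr big_distrr -big_split /=; apply: eq_bigr => E EG.
rewrite edge_subsetE //.
have := subset_leq_card (subsetIl E A); rewrite (card_edge EG).
by case: #|_| => [|[|[]]].
Qed.

Lemma inner_handshake A :
  (\sum_(v in A) #|neighbours v :&: A| = 2 * inner_edges A)%N.
Proof.
transitivity (\sum_(E in edges G | E \subset A) #|E :&: A|)%N.
  rewrite -sum_card_neighbours_edges; apply: eq_bigr => v vA; apply: eq_card => u.
  by rewrite !inE subUset !sub1set vA.
rewrite /inner_edges -sum1dep_card big_distrr /=; apply: eq_bigr => E.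
by case/andP=> EG; rewrite edge_subsetE // => /eqP.
Qed.

Lemma sum_card_neighboursIC B C :
  (\sum_(u in C) #|neighbours u :&: B| = \sum_(v in B) #|neighbours v :&: C|)%N.
Proof.
have cardE u A : #|neighbours u :&: A| = (\sum_(v in A) adj u v)%N.
  rewrite -sum1_card [RHS]big_mkcond [LHS]big_mkcond /=.
  by apply: eq_bigr => v _; rewrite !inE; case: adj; case: (v \in A).
under eq_bigr do rewrite cardE.
under [RHS]eq_bigr do rewrite cardE.
rewrite exchange_big; apply: eq_bigr => v _.
by apply: eq_bigr => u _; rewrite adj_sym.
Qed.

Lemma leaf_neighbours u v : leaf u -> adj u v -> neighbours u = [set v].
Proof.
move=> /cards1P[w Nu] uv; have : v \in neighbours u by rewrite inE.
by rewrite Nu inE => /eqP->.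
Qed.

Definition leaves : {set G} := [set v | leaf v].

Lemma sum_leaf_neighbours B :
  (\sum_(u in leaves) #|neighbours u :&: B| =
   \sum_(v in B) num_leaf_neighbours v)%N.
Proof.
rewrite sum_card_neighboursIC; apply: eq_bigr => v _.
by apply: eq_card => u; rewrite !inE.
Qed.

Definition independent A : Prop := {in A &, forall u v, ~~ adj u v}.

Lemma inner_edgesU_independent B C :
    [disjoint B & C] -> independent C ->
  inner_edges (B :|: C) = (inner_edges B + \sum_(u in C) #|neighbours u :&: B|)%N.
Proof.
move=> disBC indC; apply/eqP; rewrite -(eqn_pmul2l (isT : 0 < 2)%N) -inner_handshake.
have cardU v : #|neighbours v :&: (B :|: C)| =
               (#|neighbours v :&: B| + #|neighbours v :&: C|)%N.
  rewrite setIUr cardsU setIACA setIid.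
  by rewrite (disjoint_setI0 disBC) setI0 cards0 subn0.
rewrite (eq_bigl [predU B & C]) => [|v]; last by rewrite !inE.
under eq_bigr do rewrite cardU.
rewrite big_split /= !bigU //= inner_handshake -(sum_card_neighboursIC B C).
rewrite [X in (_ + (_ + X))%N]big1 => [|u uC]; first by apply/eqP; lia.
apply/eqP; rewrite cards_eq0 -subset0; apply/subsetP => v; rewrite !inE.
by case/andP=> uv vC; rewrite (negPf (indC u v uC vC)) in uv.
Qed.

End EdgeCounts.

Lemma big_set_split (R : Type) (idx : R) (op : Monoid.com_law idx) (T : finType)
    (D : {set T}) (F : {set T} -> R) :
  \big[op/idx]_(A : {set T}) F A =
  \big[op/idx]_(B : {set T} | B \subset ~: D)
    \big[op/idx]_(C : {set T} | C \subset D) F (B :|: C).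
Proof.
rewrite (partition_big (fun A => A :\: D) (fun B => B \subset ~: D)) /=;
  last by move=> A _; rewrite setDE subsetIr.
apply: eq_bigr => B sBD; have disBD : [disjoint B & D] by rewrite disjoints_subset.
rewrite (reindex_onto (fun C => B :|: C) (fun A => A :&: D)) /=; last first.
  by move=> A /eqP<-; rewrite setUC setID.
apply: eq_bigl => C; rewrite setIUl (disjoint_setI0 disBD) set0U setDUl.
rewrite (setDidPl disBD) (sameP eqP setIidPl).
case: (boolP (C \subset D)) => [|_]; last by rewrite andbF.
by rewrite -setD_eq0 => /eqP->; rewrite setU0 eqxx.
Qed.

Lemma prodr_1D_subset (R : comNzRingType) (T : finType) (D : {set T}) (r : T -> R) :
  \prod_(i in D) (1 + r i) = \sum_(C : {set T} | C \subset D) \prod_(i in C) r i.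
Proof.
pose rD i := if i \in D then r i else 0.
transitivity (\prod_i (rD i + 1)).
  rewrite big_mkcond; apply: eq_bigr => i _.
  by rewrite /rD addrC; case: ifP; rewrite ?add0r.
rewrite bigA_distr [RHS]big_mkcond /=; apply: eq_bigr => C _; rewrite -big_mkcond /=.
case: ifPn => [/subsetP sCD|/subsetPn[i iC iD]].
  by apply: eq_bigr => i /sCD; rewrite /rD => ->.
by rewrite (bigD1 i) //= /rD (negPf iD) mul0r.
Qed.

Lemma sum_independent (R : comNzRingType) (G : sgraph) (L : {set G}) (t : R)
    (f : G -> R) :
    independent L ->
  \sum_(A : {set G}) t ^+ inner_edges A * \prod_(v in A) f v =
  \sum_(B : {set G} | B \subset ~: L) t ^+ inner_edges B * (\prod_(v in B) f v)
      * \prod_(u in L) (1 + f u * t ^+ #|neighbours u :&: B|).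
Proof.
move=> indL; rewrite (big_set_split _ L) /=; apply: eq_bigr => B sBL.
rewrite prodr_1D_subset mulr_sumr; apply: eq_bigr => C sCL.
have disBC : [disjoint B & C].
  by rewrite disjoint_sym (disjointWl sCL) // disjoint_sym disjoints_subset.
have indC : independent C by move=> u v /(subsetP sCL) uL /(subsetP sCL); apply: indL.
rewrite inner_edgesU_independent // exprD big_split /= prodrXr.
rewrite [\prod_(v in B :|: C) _](eq_bigl [predU B & C]) => [|v]; last by rewrite !inE.
by rewrite bigU //= mulrACA [in RHS](mulrC (\prod_(i in C) _)).
Qed.

Section Connected.
Variable G : sgraph.
Hypothesis conG : connected_graph G.
Implicit Types (u v : G) (S : {set G}).

Lemma connected_closed_setT S v :
  v \in S -> {in S, forall u, neighbours u \subset S} -> S = setT.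
Proof.
move=> vS sNS; have closedS : closed (@adj G) S.
  apply: intro_closed => [|x y xy /sNS/subsetP]; first exact/sym_connect_sym/adj_sym.
  by apply; rewrite inE.
by apply/setP => x; rewrite -(closed_connect closedS (conG.2 v x)) vS inE.
Qed.

Lemma connected_deg_gt0 v : (1 < #|G|)%N -> (0 < deg v)%N.
Proof.
move=> G_gt1; rewrite lt0n; apply: contraTneq G_gt1 => /cards0_eq N0.
rewrite -leqNgt -cardsT -(connected_closed_setT (set11 v)) ?cards1 // => u.
by rewrite inE => /eqP->; rewrite N0 sub0set.
Qed.

Lemma leaves_independent : (2 < #|G|)%N -> independent (leaves G).
Proof.
move=> G_gt2 u v; rewrite !inE => lu lv; apply: contraL G_gt2 => uv.
rewrite -leqNgt -cardsT -(connected_closed_setT (set21 u v)).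
  by rewrite cards2; case: eqP.
move=> x; rewrite !inE => /orP[]/eqP->.
  by rewrite (leaf_neighbours lu uv) sub1set set22.
by rewrite adj_sym in uv; rewrite (leaf_neighbours lv uv) sub1set set21.
Qed.

End Connected.

Definition set_mnm (G : sgraph) (A : {set G}) : 'X_{1..3} :=
  [multinom [tuple #|A|; boundary_edges A; inner_edges A]].

Lemma gen_degree_polyE (G : sgraph) :
  gen_degree_poly G = \sum_(A : {set G}) 'X_[set_mnm A].
Proof.
apply: eq_bigr => A _; rewrite [in RHS]mpolyXE_id !big_ord_recl big_ord0 mulr1 mulrA.
by congr (_ ^+ _ * _ ^+ _ * _ ^+ _); congr mpolyX; congr mnm1; apply/val_inj;
  rewrite /= inordK.
Qed.

Lemma eq_gen_degree_poly_sum (G H : sgraph) (V : nmodType)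
    (f : nat -> nat -> nat -> V) :
    gen_degree_poly G = gen_degree_poly H ->
  \sum_(A : {set G}) f #|A| (boundary_edges A) (inner_edges A) =
  \sum_(A : {set H}) f #|A| (boundary_edges A) (inner_edges A).
Proof.
move=> eq_gen; pose mnms (F : sgraph) := [seq set_mnm A | A : {set F}].
pose f_mnm (m : 'X_{1..3}) := f (m 0) (m 1) (m 2%:R).
have perm_mnms : perm_eq (mnms G) (mnms H).
  by apply: (@perm_eq_sum_mpolyX _ int); rewrite !big_image -!gen_degree_polyE.
have := perm_big _ perm_mnms (op := +%R) (x := 0) (P := xpredT) (F := f_mnm).
by rewrite !big_image.
Qed.

Section LeafPolynomial.
Variables (K : comNzRingType) (y w : K).

Definition edge_weight : {poly K} := 1 + (1 - w)%:P * 'X.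

(* This is G_T at x = (X - 1) / y and z = y^2 t.  Without isolated vertices
   |A| <= d(A) + 2 e(A), so y is not inverted and the subtraction is exact. *)
Definition leaf_poly (G : sgraph) : {poly K} :=
  \sum_(A : {set G}) ('X - 1) ^+ #|A|
    * y%:P ^+ (boundary_edges A + 2 * inner_edges A - #|A|)
    * edge_weight ^+ inner_edges A.

Lemma eq_leaf_poly (G H : sgraph) :
  gen_degree_poly G = gen_degree_poly H -> leaf_poly G = leaf_poly H.
Proof.
exact: (eq_gen_degree_poly_sum
  (fun a d e => ('X - 1) ^+ a * y%:P ^+ (d + 2 * e - a) * edge_weight ^+ e)).
Qed.

Variable G : sgraph.
Hypotheses (conG : connected_graph G) (G_gt2 : (2 < #|G|)%N).

Definition vertex_weight (v : G) : {poly K} := ('X - 1) * y%:P ^+ (deg v).-1.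

Definition leaf_cofactor : {poly K} :=
  \sum_(B : {set G} | B \subset ~: leaves G)
    edge_weight ^+ inner_edges B * (\prod_(v in B) vertex_weight v)
      * (w%:P + (1 - w)%:P * 'X) ^+ (\sum_(v in B) num_leaf_neighbours v).

Lemma leaf_poly_prodE :
  leaf_poly G =
  \sum_(A : {set G}) edge_weight ^+ inner_edges A * \prod_(v in A) vertex_weight v.
Proof.
apply: eq_bigr => A _; rewrite mulrC big_split /= prodr_const prodrXr handshake.
congr (_ * (_ * _ ^+ _)); rewrite -sum1_card -sumnB => [|v _].
  by apply: eq_bigr => v _; rewrite subn1.
exact/connected_deg_gt0/ltnW.
Qed.

Lemma leaf_polyE : leaf_poly G = 'X ^+ #|leaves G| * leaf_cofactor.
Proof.
rewrite leaf_poly_prodE (sum_independent _ _ (leaves_independent conG G_gt2)).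
rewrite mulr_sumr; apply: eq_bigr => B _.
rewrite mulrCA; congr (_ * _); rewrite -sum_leaf_neighbours -prodrXr -prodr_const.
rewrite -big_split /=; apply: eq_bigr => u; rewrite inE => /eqP deg_u.
have : (#|neighbours u :&: B| <= 1)%N by rewrite -deg_u subset_leq_card ?subsetIl.
rewrite /vertex_weight deg_u expr0 mulr1 /edge_weight.
by case: #|_| => [|[|//]] _; rewrite ?polyCB; ring.
Qed.

Lemma leaf_cofactor0 :
  leaf_cofactor.[0] =
  \prod_(v in ~: leaves G) (1 - y ^+ (deg v).-1 * w ^+ num_leaf_neighbours v).
Proof.
rewrite prodr_1D_subset horner_sum; apply: eq_bigr => B _.
rewrite !hornerM !horner_exp horner_prod -prodrXr /edge_weight.
rewrite !hornerE expr1n mul1r -big_split.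
by apply: eq_bigr => v _ /=; rewrite /vertex_weight !hornerE; ring.
Qed.

End LeafPolynomial.

Lemma mulXn_cofactor_inj (K : idomainType) (a b : nat) (P Q : {poly K}) :
  P.[0] != 0 -> Q.[0] != 0 -> 'X^a * P = 'X^b * Q -> P = Q.
Proof.
wlog le_ab : a b P Q / (a <= b)%N => [IH P0 Q0 eq_PQ|P0 _].
  have [le_ab|/ltnW le_ba] := leqP a b; first exact: (IH a b).
  exact/esym/(IH b a).
rewrite -(subnKC le_ab) exprD -mulrA => /mulfI P_def; move: P0.
rewrite P_def; last by rewrite expf_neq0 ?polyX_eq0.
case: (b - a)%N => [|c]; first by rewrite mul1r.
by rewrite hornerM hornerXn expr0n mul0r eqxx.
Qed.

Definition deg_leaf_mnm (G : sgraph) (v : G) : 'X_{1..2} :=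
  [multinom [tuple (deg v).-1; num_leaf_neighbours v]].

Definition inner_mnms (G : sgraph) : seq 'X_{1..2} :=
  [seq deg_leaf_mnm v | v in ~: leaves G].

Section InnerMonomials.
Variable G : sgraph.
Hypotheses (conG : connected_graph G) (G_gt2 : (2 < #|G|)%N).

Lemma mnm0_notin_inner_mnms : 0%MM \notin inner_mnms G.
Proof.
apply/negP => /mapP[v]; rewrite mem_enum !inE /leaf => not_leaf.
move/(congr1 (fun m : 'X_{1..2} => m 0)); rewrite mnm0E -[RHS]/((deg v).-1).
by have := connected_deg_gt0 conG v (ltnW G_gt2); lia.
Qed.

Lemma prod_inner_mnms :
  \prod_(m <- inner_mnms G) (1 - 'X_[m]) =
  (leaf_cofactor 'X_0 ('X_1 : {mpoly int[2]}) G).[0].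
Proof.
rewrite leaf_cofactor0 big_image; apply: eq_bigr => v _.
by rewrite mpolyXE_id !big_ord_recl big_ord0 mulr1.
Qed.

Lemma num_deg_leafE (d l : nat) : (1 < d)%N ->
  num_deg_leaf G d l = count_mem [multinom [tuple d.-1; l]] (inner_mnms G).
Proof.
move=> d_gt1; rewrite count_map -sum1_count big_enum_cond sum1dep_card.
apply: eq_card => v; rewrite !inE /leaf /= -val_eqE /= -val_eqE /= !eqseq_cons andbT.
have := connected_deg_gt0 conG v (ltnW G_gt2).
by case: d (deg v) d_gt1 => [|[|d]] // [|[|m]].
Qed.

End InnerMonomials.

Lemma perm_eq_inner_mnms (G H : sgraph) :
    connected_graph G -> (2 < #|G|)%N -> connected_graph H -> (2 < #|H|)%N ->
    gen_degree_poly G = gen_degree_poly H ->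
  perm_eq (inner_mnms G) (inner_mnms H).
Proof.
move=> conG G_gt2 conH H_gt2 eq_gen.
have G_0 := mnm0_notin_inner_mnms conG G_gt2.
have H_0 := mnm0_notin_inner_mnms conH H_gt2.
apply: (@perm_eq_prod_1sub_mpolyX _ int) => //.
rewrite !prod_inner_mnms; congr _.[0].
apply: (@mulXn_cofactor_inj _ #|leaves G| #|leaves H|).
- by rewrite -prod_inner_mnms prod_1sub_mpolyX_neq0.
- by rewrite -prod_inner_mnms prod_1sub_mpolyX_neq0.
- by rewrite -!leaf_polyE //; apply: eq_leaf_poly.
Qed.

Theorem theorem4p9 (d l : nat) (hd : (2 <= d)%N) (T T' : sgraph)
    (hT : is_tree T) (hT' : is_tree T')
    (cT : (3 <= #|T|)%N) (cT' : (3 <= #|T'|)%N)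
    (hG : gen_degree_poly T = gen_degree_poly T') :
  num_deg_leaf T d l = num_deg_leaf T' d l.
Proof.
have [conT _] := hT; have [conT' _] := hT'.
by rewrite !num_deg_leafE //; apply/permP; apply: perm_eq_inner_mnms.
Qed.
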